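(* For any odd positive integer $n$, the algebra $\mathbb{C}[x_1,\ldots,x_n]/(x_1^2,\ldots,x_n^2)^2$ has the weak Lefschetz property.
   Context: A standard graded algebra $A=\bigoplus_i A_i$ over $\mathbb{C}$ has the weak Lefschetz property (WLP) if there exists a linear form $L\in A_1$ such that for every degree $i$ the multiplication map $\times L\colon A_i\to A_{i+1}$ has maximal rank, i.e. is injective or surjective. Here $(x_1^2,\ldots,x_n^2)^2$ is the square of the ideal generated by $x_1^2,\dots,x_n^2$. *)

(* Defs.v *)
From HB Require Import structures.
From mathcomp Require Import all_boot all_order all_algebra.
From mathcomp Require Import boolp reals.
From mathcomp Require Import complex.
From mathcomp Require Import mpoly.

Set Implicit Arguments.
Unset Strict Implicit.
Unset Printing Implicit Defensive.

Import GRing.Theory.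
Local Open Scope ring_scope.
Local Open Scope quotient_scope.

Section Ideals.
Variable R : comNzRingType.
Implicit Types (S I J : R -> Prop).

Definition ideal_gen S (p : R) : Prop :=
  exists2 s : seq (R * R),
    forall x, x \in s -> S x.2 & p = \sum_(x <- s) x.1 * x.2.

Definition ideal_mul I J : R -> Prop :=
  ideal_gen (fun p => exists f g : R, [/\ I f, J g & p = f * g]).

Lemma ideal_gen0 S : ideal_gen S 0.
Proof. by exists [::] => //; rewrite big_nil. Qed.

Lemma ideal_gen_lin S a u v :
  ideal_gen S u -> ideal_gen S v -> ideal_gen S (a * u + v).
Proof.
move=> [s Ss ->] [t St ->].
exists ([seq (a * x.1, x.2) | x <- s] ++ t).
  move=> x; rewrite mem_cat => /orP[/mapP[y ys ->]|/St //].
  exact: Ss y ys.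
rewrite big_cat big_map mulr_sumr /=; congr (_ + _).
by apply: eq_bigr => x _; rewrite mulrA.
Qed.

Lemma ideal_gen_ker (T : comNzRingType) (f : {rmorphism R -> T}) S p :
  (forall q, S q -> f q = 0) -> ideal_gen S p -> f p = 0.
Proof.
move=> fS [s Ss ->]; rewrite rmorph_sum big_seq big1 // => x xs.
by rewrite rmorphM (fS _ (Ss x xs)) mulr0.
Qed.

End Ideals.

Section WLP.
Variables (K : fieldType) (A : comAlgType K).

(* [gr d] is the homogeneous component of degree [d] of [A]. Negative degrees
   are omitted: a map out of a zero component is injective. *)
Definition mul_injective (gr : nat -> A -> Prop) (L : A) (d : nat) : Prop :=
  forall x y : A, gr d x -> gr d y -> L * x = L * y -> x = y.

Definition mul_surjective (gr : nat -> A -> Prop) (L : A) (d : nat) : Prop :=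
  forall y : A, gr d.+1 y -> exists2 x : A, gr d x & L * x = y.

Definition weak_lefschetz (gr : nat -> A -> Prop) : Prop :=
  exists2 L : A, gr 1%N L &
    forall d : nat, mul_injective gr L d \/ mul_surjective gr L d.

End WLP.

Section SquareOfSquares.
Variables (K : fieldType) (n : nat).
Local Notation P := {mpoly K[n]}.

Definition squares_ideal : P -> Prop :=
  ideal_gen (fun p : P => exists i : 'I_n, p = 'X_i ^+ 2).

Definition squares_ideal2 : P -> Prop := ideal_mul squares_ideal squares_ideal.

Definition squares_ideal2_pred : P -> bool := fun p => `[< squares_ideal2 p >].

Lemma squares_ideal2_closed : idealr_closed squares_ideal2_pred.
Proof.
split.
- by apply/asboolP; exact: ideal_gen0.
- apply/negP => /asboolP.
  move/(@ideal_gen_ker _ _ (mcoeff 0%MM : {rmorphism P -> K})) => H.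
  suff: (mcoeff 0%MM (1 : P) : K) = 0.
    by rewrite mcoeff1 eqxx => /eqP; rewrite oner_eq0.
  apply: H => q [f [g [If _ ->]]]; rewrite rmorphM.
  rewrite [X in X * _](_ : _ = 0) ?mul0r //.
  apply: (ideal_gen_ker _ If) => {q f g If} _ [i ->].
  by rewrite rmorphXn /= mcoeffX mnm1_eq0 expr0n.
- move=> a u v /asboolP Iu /asboolP Iv; apply/asboolP.
  exact: ideal_gen_lin.
Qed.

HB.instance Definition _ :=
  isIdealr.Build P squares_ideal2_pred squares_ideal2_closed.

Definition squares_ideal2_idealr : idealr P := squares_ideal2_pred.

Definition squares2_alg : Type := {ideal_quot squares_ideal2_idealr}.

HB.instance Definition _ := GRing.ComNzRing.on squares2_alg.

Definition squares2_pi : P -> squares2_alg := 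
  \pi_{ideal_quot squares_ideal2_idealr}.

HB.instance Definition _ := GRing.RMorphism.on squares2_pi.

Definition squares2_scale (c : K) (x : squares2_alg) : squares2_alg :=
  squares2_pi c%:MP * x.

Fact squares2_scaleA a b x :
  squares2_scale a (squares2_scale b x) = squares2_scale (a * b) x.
Proof. by rewrite /squares2_scale mulrA -rmorphM -mpolyCM. Qed.

Fact squares2_scale1 : left_id 1 squares2_scale.
Proof. by move=> x; rewrite /squares2_scale mpolyC1 rmorph1 mul1r. Qed.

Fact squares2_scaleDr : right_distributive squares2_scale +%R.
Proof. by move=> a x y; rewrite /squares2_scale mulrDr. Qed.

Fact squares2_scaleDl x : {morph squares2_scale^~ x : a b / a + b}.
Proof. by move=> a b; rewrite /squares2_scale mpolyCD rmorphD mulrDl. Qed.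

HB.instance Definition _ := GRing.Zmodule_isLmodule.Build K squares2_alg
  squares2_scaleA squares2_scale1 squares2_scaleDr squares2_scaleDl.

Fact squares2_scaleAl (a : K) (x y : squares2_alg) :
  a *: (x * y) = (a *: x) * y.
Proof. exact: mulrA. Qed.

HB.instance Definition _ :=
  GRing.Lmodule_isLalgebra.Build K squares2_alg squares2_scaleAl.

Fact squares2_scaleAr (a : K) (x y : squares2_alg) :
  a *: (x * y) = x * (a *: y).
Proof. exact: mulrCA. Qed.

HB.instance Definition _ :=
  GRing.Lalgebra_isAlgebra.Build K squares2_alg squares2_scaleAr.

Fact squares2_pi_scalable : scalable squares2_pi.
Proof. by move=> c p; rewrite -mul_mpolyC rmorphM. Qed.

HB.instance Definition _ :=
  GRing.isScalable.Build K P squares2_alg *:%R squares2_pi squares2_pi_scalable.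

Definition squares2_gr (d : nat) (x : squares2_alg) : Prop :=
  exists2 p : P, p \is d.-homog & x = squares2_pi p.

End SquareOfSquares.

(* Main.v *)
Require Import Defs.
From HB Require Import structures.
From mathcomp Require Import all_boot all_order all_algebra.
From mathcomp Require Import boolp reals complex mpoly ring zify.

(** Modulo [(x_1^2, ..., x_n^2)^2] a polynomial is determined by its
    coefficients on the monomials [x_S] and [x_j^2 x_S], where [S] ranges over
    the subsets of the variables and [j] may belong to [S]. The algebra is thus
    an extension of [E = C[x]/(x_1^2, ..., x_n^2)], the functions on the Boolean
    lattice, by [n] copies of [E] shifted by two degrees, and multiplication by
    [L = x_1 + ... + x_n] sends [(f, (g_j)_j)] to [(L f, (L g_j + d_j f)_j)] with
    [d_j] the partial derivative. On [E], [L] and [D = d_1 + ... + d_n] satisfy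
    the sl2 relation [D L - L D = n - 2 d] in degree [d], whence the strong
    Lefschetz property of [E]. With [n = 2 m + 1], this gives injectivity in
    degrees [d <= m] and surjectivity in degrees [d >= m + 2]. In degree [m + 1],
    a kernel element satisfies [L f = 0] and [D f = L h] with
    [h = - \sum_j g_j] in degree [m - 1]; the sl2 relation gives
    [f = L D f = L^2 h], so [L^3 h = 0], hence [h = 0] and [f = 0]. *)

Set Implicit Arguments.
Unset Strict Implicit.
Unset Printing Implicit Defensive.

Import GRing.Theory Num.Theory.
Local Open Scope ring_scope.

(** * Lefschetz maps on a graded module with an sl2 commutation relation *)

Section Sl2.
Variables (K : numFieldType) (V : lmodType K) (n : nat).
Variables (L D : {linear V -> V}) (gr : nat -> {pred V}).
Hypothesis gr_submod : forall d, submod_closed (gr d).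
Hypothesis gr_gt : forall d v, (n < d)%N -> v \in gr d -> v = 0.
Hypothesis grL : forall d v, v \in gr d -> L v \in gr d.+1.
Hypothesis grD : forall d v, v \in gr d.+1 -> D v \in gr d.
Hypothesis grD0 : forall v, v \in gr 0%N -> D v = 0.
Hypothesis commDL : forall d v, v \in gr d ->
  D (L v) = L (D v) + (n%:R - (2 * d)%N%:R) *: v.

Lemma gr_iter k d v : v \in gr d -> iter k L v \in gr (d + k).
Proof.
by move=> gv; elim: k => [|k IHk]; rewrite ?addn0 // addnS; exact: grL.
Qed.

Lemma iterL_lin k a u v :
  iter k L (a *: u + v) = a *: iter k L u + iter k L v.
Proof. by elim: k => //= k ->; rewrite linearP. Qed.

Lemma iterL0 k : iter k L 0 = 0.
Proof. by elim: k => //= k ->; rewrite linear0. Qed.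

(** Moving [D] past the factors [L] one by one adds [n - 2 (d + i)] for [i = 0, ..., k]; these
    scalars sum to [(k + 1) (n - 2 d - k)]. *)
Lemma commD_iterL k d v : v \in gr d ->
  D (iter k.+1 L v) = iter k.+1 L (D v) +
    (k.+1%:R * (n%:R - (2 * d + k)%N%:R)) *: iter k L v.
Proof.
move=> gv; elim: k => [|k IHk].
  by rewrite /= (commDL gv) addn0 mul1r.
have := gr_iter k.+1 gv; rewrite [iter k.+2 L v]iterS => /commDL ->.
rewrite IHk linearD linearZ /= -addrA -scalerDl; congr (_ + _ *: _).
by ring.
Qed.

Lemma commD_iterL_neq0 k d : n != (2 * d + k)%N ->
  k.+1%:R * (n%:R - (2 * d + k)%N%:R) != 0 :> K.
Proof. by move=> nE; rewrite mulf_eq0 pnatr_eq0 subr_eq0 eqr_nat. Qed.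

(** Induction on the degree: by [commD_iterL], [L^(k+1)] kills [D v], so [D v = 0]. The same formula
    then strips one [L] at a time from [L^k v = 0]. *)
Lemma iterL_inj k d v :
  (k + 2 * d <= n)%N -> v \in gr d -> iter k L v = 0 -> v = 0.
Proof.
elim: d k v => [|d IHd] k v kd gv kv0.
all: have Dv0 : D v = 0.
1: exact: grD0.
2: { apply: (IHd k.+1); [lia | exact: grD |].
     have := commD_iterL k gv.
     by rewrite kv0 scaler0 addr0 /= kv0 !linear0. }
all: elim: k kd kv0 => // k IHk kd kv0; apply: IHk; first by lia.
all: have := commD_iterL k gv.
all: rewrite kv0 Dv0 iterL0 linear0 add0r => /esym/eqP.
all: rewrite scaler_eq0 (negPf (commD_iterL_neq0 _)) => [/eqP //|]; lia.
Qed.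

(** Starting from [L^n w = 0], which holds for degree reasons, one descends from
    [L^(k+1) w = L^(k+2) u] to [L^k w = L^(k+1) u'], until [w = L u]. *)
Lemma L_surj e w :
  (n < 2 * e.+1)%N -> w \in gr e.+1 -> exists2 u, u \in gr e & L u = w.
Proof.
move=> ne gw.
have LDgr u : u \in gr e -> L (D u) \in gr e.
  case: {ne gw} e => [/grD0->|d /grD/grL //].
  by rewrite linear0; exact: (gr_submod 0%N).1.
have: exists2 u, u \in gr e & iter n L w = iter n.+1 L u.
  exists 0; first exact: (gr_submod e).1.
  by rewrite iterL0; apply: gr_gt (gr_iter n gw); rewrite addSn ltnS leq_addl.
elim: {1 2}n => [|k IHk] [u gu wu]; first by exists u.
apply: IHk.
set c := k.+1%:R * (n%:R - (2 * e.+1 + k)%N%:R) : K.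
have c0 : c != 0 by apply: commD_iterL_neq0; lia.
set c' := k.+2%:R * (n%:R - (2 * e + k.+1)%N%:R) : K.
(* Applying [D] to both sides of [wu] and solving for [L^k w] yields this element; [-1 *:] and [+ 0]
   give it the shape required by [submod_closed]. *)
exists (c^-1 *: (-1 *: D w + (c' *: u + L (D u))) + 0).
  have [gr0 grP] := gr_submod e.
  apply: (grP) gr0; apply: (grP); first exact: grD.
  by apply: (grP) => //; exact: LDgr.
have := commD_iterL k.+1 gu; rewrite -wu (commD_iterL k gw) -/c -/c' => cE.
rewrite iterL_lin iterL0 addr0 iterL_lin iterL_lin -[iter _ L (L _)]iterSr.
rewrite [_ *: iter _ _ u + _]addrC -cE scaleN1r addrA addNr add0r.
by rewrite scalerA mulVf ?scale1r.
Qed.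

End Sl2.

(** * The sl2 action on functions on the Boolean lattice *)

Section BooleanLattice.
Variables (K : numFieldType) (n : nat).
Local Notation V := {ffun {set 'I_n} -> K^o}.
Implicit Types (f g : V) (S : {set 'I_n}) (d : nat).

(** With [f S] read as the coefficient of [x_S], this is multiplication by the sum of the variables
    modulo their squares, and [deriv_at j] is the partial derivative in [x_j]. *)
Definition up f : V := [ffun S : {set _} => \sum_(i in S) f (S :\ i)].
Definition deriv_at (j : 'I_n) f : V :=
  [ffun S : {set _} => if j \in S then 0 else f (j |: S)].
Definition down f : V := \sum_j deriv_at j f.
Definition layer d : {pred V} :=
  [pred f : V | [forall S : {set 'I_n}, (f S != 0) ==> (#|S| == d)]].

Lemma layerP d f : reflect (forall S, #|S| <> d -> f S = 0) (f \in layer d).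
Proof.
apply: (iffP forallP) => fd S.
  by move=> Sd; apply: contraTeq (fd S) => fS; rewrite fS; apply/eqP.
by apply/implyP; apply: contraNT => /eqP/fd->.
Qed.

Lemma up_linear : linear up.
Proof.
move=> a f g; apply/ffunP => S; rewrite !ffunE scaler_sumr -big_split.
by apply: eq_bigr => i _; rewrite !ffunE.
Qed.
HB.instance Definition _ := GRing.isLinear.Build K V V _ up up_linear.

Lemma deriv_at_linear j : linear (deriv_at j).
Proof.
move=> a f g; apply/ffunP => S; rewrite !ffunE.
by case: ifP; rewrite ?scaler0 ?addr0.
Qed.
HB.instance Definition _ j :=
  GRing.isLinear.Build K V V _ (deriv_at j) (deriv_at_linear j).

Lemma down_linear : linear down.
Proof.
move=> a f g; rewrite /down scaler_sumr -big_split.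
by apply: eq_bigr => j _; rewrite linearP.
Qed.
HB.instance Definition _ := GRing.isLinear.Build K V V _ down down_linear.

Lemma downE f S : down f S = \sum_(j in ~: S) f (j |: S).
Proof.
rewrite /down sum_ffunE [RHS]big_mkcond; apply: eq_bigr => j _.
by rewrite ffunE inE; case: ifP.
Qed.

(** Both composites contain the same sum over exchanges of some [i] in [S] with some [j] outside.
    The other terms return to [S] itself: [#|~: S|] of them on the left, [#|S|] on the right. *)
Lemma down_up f S :
  down (up f) S = up (down f) S + (n%:R - (2 * #|S|)%N%:R) *: f S.
Proof.
have -> : down (up f) S =
    \sum_(j in ~: S) \sum_(i in S) f (j |: S :\ i) + f S *+ #|~: S|.
  rewrite downE -sumr_const -big_split /=; apply: eq_bigr => j.
  rewrite inE => jS; rewrite ffunE big_setU1 //= setU1K // addrC.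
  congr (_ + _); apply: eq_bigr => i iS; congr (f _); apply/setP => k.
  rewrite !inE; case: (eqVneq k j) => // ->.
  by case: (eqVneq j i) jS => // ->; rewrite iS.
have -> : up (down f) S =
    \sum_(i in S) \sum_(j in ~: S) f (j |: S :\ i) + f S *+ #|S|.
  rewrite ffunE -sumr_const -big_split /=; apply: eq_bigr => i iS.
  rewrite downE; have -> : ~: (S :\ i) = i |: ~: S.
    by apply/setP => k; rewrite !inE negb_and negbK.
  by rewrite big_setU1 ?inE ?iS //= addrC setD1K.
rewrite exchange_big /= -addrA; congr (_ + _).
rewrite -!scaler_nat -scalerDl; congr (_ *: _).
have -> : n%:R = (#|S| + #|~: S|)%N%:R :> K by rewrite cardsC card_ord.
by ring.
Qed.

Lemma layer_submod d : submod_closed (layer d).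
Proof.
split=> [|a f g /layerP fd /layerP gd]; apply/layerP => S Sd; rewrite !ffunE //.
by rewrite fd ?gd // scaler0 addr0.
Qed.

Lemma layer_gt d f : (n < d)%N -> f \in layer d -> f = 0.
Proof.
move=> nd /layerP fd; apply/ffunP => S; rewrite ffunE fd //.
by have := max_card S; rewrite card_ord; lia.
Qed.

Lemma up_layer d f : f \in layer d -> up f \in layer d.+1.
Proof.
move=> /layerP fd; apply/layerP => S Sd; rewrite ffunE big1 // => i iS.
by apply: fd; move: Sd; rewrite (cardsD1 i S) iS; lia.
Qed.

Lemma deriv_at_layer j d f : f \in layer d.+1 -> deriv_at j f \in layer d.
Proof.
move=> /layerP fd; apply/layerP => S Sd; rewrite ffunE.
by case: ifPn => // jS; apply: fd; rewrite cardsU1 jS; lia.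
Qed.

Lemma deriv_at_layer0 j f : f \in layer 0 -> deriv_at j f = 0.
Proof.
move=> /layerP fd; apply/ffunP => S; rewrite !ffunE; case: ifPn => // jS.
by apply: fd; rewrite cardsU1 jS.
Qed.

Lemma down_layer d f : f \in layer d.+1 -> down f \in layer d.
Proof.
move=> fd; have [layer0 layer_lin] := layer_submod d.
apply: (big_ind (fun g => g \in layer d)) => [//|g h gd hd|j _].
- by rewrite -[g]scale1r; apply: (layer_lin).
- exact: deriv_at_layer.
Qed.

Lemma down_layer0 f : f \in layer 0 -> down f = 0.
Proof. by move=> f0; apply: big1 => j _; exact: deriv_at_layer0. Qed.

Lemma down_up_layer d f : f \in layer d ->
  down (up f) = up (down f) + (n%:R - (2 * d)%N%:R) *: f.
Proof.
move=> /layerP fd; apply/ffunP => S; rewrite down_up !ffunE.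
by have [->//|/eqP/fd->] := eqVneq #|S| d; rewrite !scaler0.
Qed.

Lemma iter_up_inj k d f :
  (k + 2 * d <= n)%N -> f \in layer d -> iter k up f = 0 -> f = 0.
Proof.
exact: (@iterL_inj K V n up down layer up_layer
  down_layer down_layer0 down_up_layer).
Qed.

Lemma up_surj d f : (n < 2 * d.+1)%N -> f \in layer d.+1 ->
  exists2 g, g \in layer d & up g = f.
Proof.
exact: (@L_surj K V n up down layer layer_submod layer_gt up_layer
  down_layer down_layer0 down_up_layer).
Qed.

Lemma up_middle_inj m f h : n = m.*2.+1 ->
  f \in layer m.+1 -> up f = 0 -> down f = up h ->
  (forall S, #|S|.+1 <> m -> h S = 0) -> f = 0.
Proof.
move=> nE fm f0 dfE hm.
have fE : f = up (up h).
  have := down_up_layer fm; rewrite f0 linear0 dfE => /esym/eqP.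
  rewrite addrC addr_eq0 => /eqP fE.
  have cE : n%:R - (2 * m.+1)%N%:R = -1 :> K by rewrite nE -addnn; ring.
  by move: fE; rewrite cE scaleN1r => /oppr_inj.
suff h0 : h = 0 by rewrite fE h0 !linear0.
(* For [m = 0] there is no degree [m - 1], and [hm], phrased with [#|S|.+1], makes [h] vanish
   outright. *)
case: m nE fm hm => [|m] nE fm hm; first by apply/ffunP => S; rewrite ffunE hm.
(* Now [n = 2 m + 3] after the shift of [m], so the bound [3 + 2 m <= n] is attained. *)
apply: (@iter_up_inj 3 m); first by lia.
  by apply/layerP => S Sm; apply: hm; lia.
by rewrite /= -fE.
Qed.

End BooleanLattice.

(** * Coefficients modulo the squared ideal *)

Section Coefficients.
Variables (K : numFieldType) (n : nat).
Local Notation P := {mpoly K[n]}.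
Local Notation V := {ffun {set 'I_n} -> K^o}.
Implicit Types (p q : P) (m : 'X_{1..n}) (S T : {set 'I_n}) (i j : 'I_n).

(* [squares_ideal2] is spanned by the monomials of [sqweight] at least 2. *)
Definition sqweight m : nat := \sum_i (m i)./2.

Definition sqfree S : 'X_{1..n} := [multinom (i \in S : nat) | i < n].

Definition sqfree_coef p : V := [ffun S => p@_(sqfree S)].
Definition sq_coef j p : V := [ffun S => p@_(sqfree S + U_(j) *+ 2)].

Definition sqorder_ge k p : Prop := forall m, (sqweight m < k)%N -> p@_m = 0.

Lemma sqweightD m1 m2 :
  (sqweight m1 + sqweight m2 <= sqweight (m1 + m2))%N.
Proof.
rewrite /sqweight -big_split; apply: leq_sum => i _; rewrite mnmDE /=; lia.
Qed.

Lemma sqweight_sqfree S : sqweight (sqfree S) = 0%N.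
Proof. by apply: big1 => i _; rewrite mnmE; case: (i \in S). Qed.

Lemma sqweight_sqfreeU2 S j : sqweight (sqfree S + U_(j) *+ 2) = 1%N.
Proof.
rewrite /sqweight (bigD1 j) //= big1 => [|i /negPf ij]; rewrite !mnmE.
  by rewrite eqxx; case: (j \in S).
by rewrite eq_sym ij; case: (i \in S).
Qed.

Definition odd_part m : {set 'I_n} := [set i | odd (m i)].

Lemma odd_part_sqfree S : odd_part (sqfree S) = S.
Proof. by apply/setP => i; rewrite inE mnmE oddb. Qed.

Lemma odd_part_sqfreeU2 S j : odd_part (sqfree S + U_(j) *+ 2) = S.
Proof.
by apply/setP => i; rewrite inE mnmDE mulmnE mnmE oddD oddb oddM andbF addbF.
Qed.

(** All exponents are at most 1, except possibly one equal to 2 or 3. *)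
Lemma sqweight_le1 m : (sqweight m < 2)%N ->
  m = sqfree (odd_part m) \/
  exists j, m = (sqfree (odd_part m) + U_(j) *+ 2)%MM.
Proof.
move=> m2; have [/eqP|] := posnP (sqweight m).
  rewrite sum_nat_eq0 => /forallP m0; left; apply/mnmP => i.
  by rewrite mnmE inE; have /eqP := m0 i; lia.
rewrite lt0n sum_nat_eq0 => /forallPn[j mj]; right; exists j.
apply/mnmP => i; rewrite !mnmE inE; move: m2; rewrite /sqweight.
rewrite (bigD1 j) //=; have [<-|ji] := eqVneq j i; first by move: mj => /=; lia.
by rewrite (bigD1 i) 1?eq_sym //=; move: mj => /=; lia.
Qed.

Lemma sqorder_ge_lin k a p q :
  sqorder_ge k p -> sqorder_ge k q -> sqorder_ge k (a * p + q).
Proof.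
move=> pk qk m mk; rewrite mcoeffD qk // addr0 mcoeffM big1 // => k' /eqP mE.
have := sqweightD k'.1 k'.2; rewrite -mE => le.
rewrite (pk k'.2) ?mulr0 //.
exact: leq_ltn_trans (leq_trans (leq_addl _ _) le) mk.
Qed.

Lemma sqorder_geM k l p q :
  sqorder_ge k p -> sqorder_ge l q -> sqorder_ge (k + l) (p * q).
Proof.
move=> pk ql m mkl; rewrite mcoeffM big1 // => k' /eqP mE.
have := sqweightD k'.1 k'.2; rewrite -mE => le.
have [/pk->|k1] := ltnP (sqweight k'.1) k; first by rewrite mul0r.
rewrite (ql k'.2) ?mulr0 // -(ltn_add2l k).
by apply: leq_ltn_trans mkl; apply: leq_trans le; rewrite leq_add2r.
Qed.

Lemma ideal_gen_sqorder k (I : P -> Prop) p :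
  (forall q, I q -> sqorder_ge k q) -> ideal_gen I p -> sqorder_ge k p.
Proof.
move=> Ik [s sI ->]; rewrite big_seq.
apply: (big_rec (sqorder_ge k)) => [m _|x q xs qk]; first by rewrite mcoeff0.
by apply: sqorder_ge_lin => //; apply/Ik/sI.
Qed.

Lemma ideal_gen_mull (I : P -> Prop) a p : ideal_gen I p -> ideal_gen I (a * p).
Proof.
by move=> Ip; rewrite -[a * p]addr0; apply: ideal_gen_lin => //;
  exact: ideal_gen0.
Qed.

Lemma ideal_gen_gen (I : P -> Prop) p : I p -> ideal_gen I p.
Proof.
move=> Ip; exists [:: (1, p)]; last by rewrite big_seq1 mul1r.
by move=> x; rewrite inE => /eqP->.
Qed.

Lemma sqweight_gt0 m : (0 < sqweight m)%N ->
  exists j, m = (m - U_(j) *+ 2 + U_(j) *+ 2)%MM.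
Proof.
rewrite lt0n sum_nat_eq0 => /forallPn[j mj]; exists j.
rewrite submK //; apply/mnm_lepP => i; rewrite mulmnE mnm1E.
by case: (eqVneq j i) mj => [<-|_] /=; lia.
Qed.

Lemma sq_var_order p : (exists i, p = 'X_i ^+ 2) -> sqorder_ge 1 p.
Proof.
move=> [j ->] m m0; rewrite mcoeffXn; case: eqP => // mE.
suff : sqweight (sqfree set0 + U_(j) *+ 2) = sqweight m.
  by rewrite sqweight_sqfreeU2; lia.
by rewrite -mE; congr sqweight; apply/mnmP => i; rewrite !mnmE inE.
Qed.

(** Orders add under products, which gives one direction. Conversely, every monomial of [p] is
    divisible by some [x_i^2 x_j^2], with [i = j] allowed. *)
Lemma squares_ideal2P p : squares_ideal2 p <-> sqorder_ge 2 p.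
Proof.
split=> [|p2].
  apply: ideal_gen_sqorder => _ [f [g [If Ig ->]]]; apply: (@sqorder_geM 1 1).
    exact: ideal_gen_sqorder sq_var_order If.
  exact: ideal_gen_sqorder sq_var_order Ig.
rewrite (mpolyE p) big_seq; apply: (big_rec (@squares_ideal2 K n)).
  exact: ideal_gen0.
move=> m q mp Iq; rewrite -mul_mpolyC; apply: ideal_gen_lin Iq.
have m2 : (1 < sqweight m)%N.
  by rewrite ltnNge; apply: contraL mp => ?; rewrite mcoeff_msupp p2 ?eqxx.
have [j mE] := sqweight_gt0 (ltnW m2).
(* Removing [x_j^2] lowers the weight by exactly 1, so a second square can be extracted. *)
have /sqweight_gt0[i m'E] : (0 < sqweight (m - U_(j) *+ 2))%N.
  have := sqweight_sqfreeU2 set0 j; have -> : sqfree set0 = 0%MM.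
    by apply/mnmP => i; rewrite !mnmE inE.
  have : sqweight m = sqweight (m - U_(j) *+ 2) + sqweight (U_(j) *+ 2).
    rewrite /sqweight -big_split; apply: eq_bigr => i _ /=.
    by rewrite {1}mE !mnmE; lia.
  by rewrite add0m; lia.
rewrite mE m'E 2!mpolyXD -mulrA; apply: ideal_gen_mull.
apply: ideal_gen_gen; exists 'X_[U_(i) *+ 2], 'X_[U_(j) *+ 2].
have sqI k : squares_ideal ('X_[U_(k) *+ 2] : P).
  by apply: ideal_gen_gen; exists k; rewrite mpolyXn.
by split.
Qed.

(** By [sqweight_le1] these are all the coefficients in weights 0 and 1, the only ones that
    [squares_ideal2P] constrains. *)
Lemma squares2_piP p q : squares2_pi p = squares2_pi q <->
  sqfree_coef p = sqfree_coef q /\ forall j, sq_coef j p = sq_coef j q.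
Proof.
have -> : squares2_pi p = squares2_pi q <-> sqorder_ge 2 (p - q).
  have := Quotient.idealrBE (@squares_ideal2_idealr K n) p q.
  rewrite unfold_in /= => pqE; rewrite -squares_ideal2P.
  split=> [/eqP|/asboolP]; first by rewrite -pqE => /asboolP.
  by move=> pq; apply/eqP; rewrite -pqE.
split=> [pq|[pq0 pq1] m /sqweight_le1[->|[j ->]]].
- split=> [|j]; apply/ffunP => S; rewrite !ffunE; apply/eqP.
    by rewrite -subr_eq0 -mcoeffB pq // sqweight_sqfree.
  by rewrite -subr_eq0 -mcoeffB pq // sqweight_sqfreeU2.
- apply/eqP; rewrite mcoeffB subr_eq0; apply/eqP.
  by move/ffunP/(_ (odd_part m)): pq0; rewrite !ffunE.
- apply/eqP; rewrite mcoeffB subr_eq0; apply/eqP.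
  by move/ffunP/(_ (odd_part m)): (pq1 j); rewrite !ffunE.
Qed.

(** * Multiplication by the sum of the variables, on coefficients *)

Lemma mcoeffXM p i m :
  ('X_i * p)@_m = if (0 < m i)%N then p@_(m - U_(i)) else 0.
Proof.
case: ifP => mi.
  have {1}-> : m = (U_(i) + (m - U_(i)))%MM.
    apply/mnmP => j; rewrite !mnmE; case: eqP => [<-|]; lia.
  by rewrite mulrC mcoeffMX.
rewrite mcoeffM big1 // => -[k l] /= /eqP mE; rewrite mcoeffX.
case: eqP => [kE|]; rewrite ?mul0r //.
by move/mnmP/(_ i): mE mi; rewrite -kE !mnmE eqxx => ->.
Qed.

Definition sum_vars : P := \sum_i 'X_i.

Lemma mcoeff_sum_varsM p m :
  (sum_vars * p)@_m = \sum_(i | (0 < m i)%N) p@_(m - U_(i)).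
Proof.
rewrite mulr_suml raddf_sum [RHS]big_mkcond.
by apply: eq_bigr => i _; rewrite /= mcoeffXM.
Qed.

Lemma sqfree_coefM p : sqfree_coef (sum_vars * p) = up (sqfree_coef p).
Proof.
apply/ffunP => S; rewrite !ffunE mcoeff_sum_varsM.
apply: eq_big => [i|i]; rewrite mnmE ?lt0b // => iS; rewrite ffunE.
congr (_@__); apply/mnmP => j; rewrite !mnmE !inE.
by case: (eqVneq i j) iS => [<- ->|_ _] //=; rewrite subn0.
Qed.

(** Dividing [x_j^2 x_S] by [x_i] with [i] in [S] stays in the family [sq_coef j]. Dividing by [x_j]
    when [j] is not in [S] gives the squarefree [x_j x_S], whence the derivative. *)
Lemma sq_coefM j p :
  sq_coef j (sum_vars * p) = up (sq_coef j p) + deriv_at j (sqfree_coef p).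
Proof.
apply/ffunP => S; rewrite !ffunE mcoeff_sum_varsM.
have addE i T : i \notin T -> sqfree (i |: T) = (sqfree T + U_(i))%MM.
  move=> iT; apply/mnmP => k; rewrite !mnmE !inE.
  by case: (eqVneq i k) iT => [<- /negPf->|_ _] //=; rewrite addn0.
have inS : \sum_(i in S) p@_(sqfree S + U_(j) *+ 2 - U_(i)) =
    \sum_(i in S) sq_coef j p (S :\ i).
  apply: eq_bigr => i iS; rewrite ffunE; congr (_@__).
  have {1}-> : sqfree S = (sqfree (S :\ i) + U_(i))%MM.
    by rewrite -addE ?setD1K // !inE eqxx.
  by apply/mnmP => k; rewrite !mnmE addnAC addnK.
have [jS|jS] := ifPn.
  rewrite addr0 -inS; apply: eq_bigl => i; rewrite !mnmE.
  by case: (eqVneq j i) jS => [<- ->|_ _] //; rewrite addn0 lt0b.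
rewrite (bigD1 j) ?mnmE ?eqxx ?addn_gt0 ?orbT //= addrC; congr (_ + _).
  rewrite -inS; apply: eq_bigl => i; rewrite !mnmE.
  by case: (eqVneq j i) jS => [<- /negPf->|_ _] /=;
    rewrite ?andbF ?addn0 ?andbT ?lt0b.
rewrite addE //; congr (_@__); apply/mnmP => k; rewrite !mnmE; lia.
Qed.

Lemma mdeg_sqfree S : mdeg (sqfree S) = #|S|.
Proof.
rewrite mdegE -sum1_card [RHS]big_mkcond; apply: eq_bigr => i _.
by rewrite mnmE; case: (i \in S).
Qed.

Lemma sqfree_coef_layer d p : p \is d.-homog -> sqfree_coef p \in layer d.
Proof.
move=> pd; apply/layerP => S /eqP Sd; rewrite ffunE.
by apply: dhomog_nemf_coeff pd _; rewrite /= mdeg_sqfree.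
Qed.

Lemma sq_coef_eq0 d p j S :
  p \is d.-homog -> #|S|.+2 <> d -> sq_coef j p S = 0.
Proof.
move=> pd /eqP Sd; rewrite ffunE; apply: dhomog_nemf_coeff pd _.
by rewrite /= mdegD mdegMn mdeg1 mdeg_sqfree addn2.
Qed.

(** The monomials in the explicit sum are distinct: [sqweight] separates the two families,
    [odd_part] recovers [S], and comparing exponents then recovers [j]. *)
Lemma coef_surj d (f : V) (g : 'I_n -> V) :
  f \in layer d.+2 -> (forall j, g j \in layer d) ->
  exists p, [/\ p \is d.+2.-homog, sqfree_coef p = f &
    forall j, sq_coef j p = g j].
Proof.
move=> /layerP fd gd.
exists (\sum_S f S *: 'X_[sqfree S] +
  \sum_j \sum_S g j S *: 'X_[sqfree S + U_(j) *+ 2]).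
split=> [||j].
- apply: dhomogD.
    apply: rpred_sum => S _; have [Sd|/eqP Sd] := eqVneq #|S| d.+2.
      by rewrite rpredZ // dhomogX /= mdeg_sqfree Sd.
    by rewrite fd // scale0r rpred0.
  apply: rpred_sum => j _; apply: rpred_sum => S _.
  have [Sd|/eqP Sd] := eqVneq #|S| d.
    by rewrite rpredZ // dhomogX /= mdegD mdegMn mdeg1 mdeg_sqfree Sd addn2.
  by have /layerP-> := gd j; rewrite // scale0r rpred0.
- apply/ffunP => S; rewrite ffunE mcoeffD !raddf_sum (bigD1 S) //=.
  rewrite mcoeffZ mcoeffX eqxx mulr1 !big1 ?addr0 // => [j _|T TS].
    rewrite raddf_sum big1 //= => T _; rewrite mcoeffZ mcoeffX.
    by case: eqP => [/(congr1 sqweight)|]; rewrite ?mulr0 //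
      sqweight_sqfree sqweight_sqfreeU2.
  rewrite mcoeffZ mcoeffX.
  case: eqP => [/(congr1 odd_part)|]; rewrite ?mulr0 //.
  by rewrite !odd_part_sqfree => /eqP; rewrite (negPf TS).
- apply/ffunP => S; rewrite ffunE mcoeffD !raddf_sum big1 => [|T _]; last first.
    rewrite /= mcoeffZ mcoeffX.
    case: eqP => [/(congr1 sqweight)|]; rewrite ?mulr0 //.
    by rewrite sqweight_sqfree sqweight_sqfreeU2.
  rewrite add0r (bigD1 j) //= raddf_sum (bigD1 S) //=.
  rewrite mcoeffZ mcoeffX eqxx mulr1.
  rewrite !big1 ?addr0 // => [i ij|T TS].
    rewrite raddf_sum big1 //= => T _; rewrite mcoeffZ mcoeffX.
    case: eqP => [E|]; rewrite ?mulr0 //.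
    have := congr1 odd_part E; rewrite !odd_part_sqfreeU2 => TS.
    by move/mnmP/(_ i): E; rewrite TS !mnmE eqxx eq_sym (negPf ij); lia.
  rewrite mcoeffZ mcoeffX.
  case: eqP => [/(congr1 odd_part)|]; rewrite ?mulr0 //.
  by rewrite !odd_part_sqfreeU2 => /eqP; rewrite (negPf TS).
Qed.

End Coefficients.

(** * Injectivity and surjectivity in the quotient for odd [n] *)

Section WeakLefschetz.
Variables (K : numFieldType) (m : nat).
Local Notation n := m.*2.+1.
Local Notation L := (squares2_pi (sum_vars K n)).

Lemma mul_ker d (p : {mpoly K[n]}) : (d <= m.+1)%N -> p \is d.-homog ->
  L * squares2_pi p = 0 -> squares2_pi p = 0.
Proof.
move=> dm pd; rewrite -rmorphM -[0](rmorph0 (@squares2_pi K n)).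
have coef0 : sqfree_coef (0 : {mpoly K[n]}) = 0 /\
    forall j, sq_coef j (0 : {mpoly K[n]}) = 0.
  by split=> [|j]; apply/ffunP => S; rewrite !ffunE mcoeff0.
case/squares2_piP; rewrite coef0.1 sqfree_coefM => f0 g0.
have {}g0 j : up (sq_coef j p) = - deriv_at j (sqfree_coef p).
  by apply/eqP; rewrite -addr_eq0 -sq_coefM g0 coef0.2.
have fd := sqfree_coef_layer pd.
have f_eq0 : sqfree_coef p = 0.
  move: dm; rewrite leq_eqVlt => /orP[/eqP dE|dm]; last first.
    by apply: (iter_up_inj (k := 1) _ fd f0); lia.
  rewrite dE in fd pd.
  (* Summing the relations [g0] over [j] gives [down f = up h]. *)
  apply: (up_middle_inj (h := - \sum_j sq_coef j p) erefl fd f0).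
    rewrite linearN linear_sum /down -sumrN; apply: eq_bigr => j _.
    by rewrite /= g0 opprK.
  move=> S Sm; rewrite ffunE sum_ffunE big1 ?oppr0 // => j _.
  by apply: sq_coef_eq0 pd _; lia.
apply/squares2_piP; rewrite coef0.1; split=> // j; rewrite coef0.2.
(* The functions [sq_coef j p] live in degree [d - 2], so they vanish for [d < 2]. *)
case: d dm pd {fd} => [|[|d]] dm pd.
1,2: by apply/ffunP => S; rewrite [RHS]ffunE; apply: sq_coef_eq0 pd _.
apply: (iter_up_inj (k := 1) (d := d)); first by lia.
  by apply/layerP => S Sd; apply: sq_coef_eq0 pd _; lia.
by rewrite /= g0 f_eq0 linear0 oppr0.
Qed.

(** The system is triangular: [f] is found first, then each [g_j] from [L g_j = p_j - d_j f]. The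
    latter equations, two degrees lower, dictate the bound on [d]. *)
Lemma mul_surj d (p : {mpoly K[n]}) : (m.+1 < d)%N -> p \is d.+1.-homog ->
  exists2 q, q \is d.-homog & L * squares2_pi q = squares2_pi p.
Proof.
case: d => [|[|d]] // md pd.
have [||f fd fE] := @up_surj K n d.+2 (sqfree_coef p); first by lia.
  exact: sqfree_coef_layer.
have g_ex j : exists g, g \in layer d /\
    up g = sq_coef j p - deriv_at j f.
  have [||g gd gE] := @up_surj K n d (sq_coef j p - deriv_at j f).
  - by lia.
  - have /layerP fd' := deriv_at_layer j fd.
    apply/layerP => S Sd; have := fd' S Sd; rewrite !ffunE => ->.
    have := sq_coef_eq0 (S := S) j pd; rewrite ffunE => ->; last by lia.
    by rewrite subr0.
  - by exists g.
have [g gP] := choice g_ex.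
have [q [qd qf qg]] := coef_surj fd (fun j => (gP j).1).
exists q => //; rewrite -rmorphM; apply/squares2_piP.
rewrite sqfree_coefM qf; split=> // j.
by rewrite sq_coefM qf qg (gP j).2 subrK.
Qed.

End WeakLefschetz.

Lemma squares2_weak_lefschetz (K : numFieldType) (n : nat) : odd n ->
  weak_lefschetz (@squares2_gr K n).
Proof.
move=> n_odd; rewrite -(odd_double_half n) n_odd add1n.
set m := n./2; exists (squares2_pi (sum_vars K m.*2.+1)).
  exists (sum_vars K m.*2.+1) => //.
  by apply: rpred_sum => i _; rewrite dhomogX /= mdeg1.
move=> d; have [dm|dm] := leqP d m.+1; [left|right].
  move=> _ _ [p pd ->] [q qd ->] /eqP; rewrite -subr_eq0 -mulrBr -rmorphB.
  move=> /eqP pq0; apply/eqP; rewrite -subr_eq0 -rmorphB; apply/eqP.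
  by apply: mul_ker dm _ pq0; exact: rpredB.
move=> _ [p pd ->]; have [q qd qE] := mul_surj dm pd.
by exists (squares2_pi q) => //; exists q.
Qed.

Theorem theorem22 (R : realType) (n : nat) (hn : odd n) :
  @weak_lefschetz R[i] (squares2_alg R[i] n) (@squares2_gr R[i] n).
Proof. exact: squares2_weak_lefschetz. Qed.
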